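(* Let $n\ge 3$ be an integer, let $R>0$, and let $S_n\subset\mathbb{R}^3$ be the surface with regular $n$-gonal base of inradius $R$ and height $R$ described in the context. Then $S_n$ has the parametric representation $$x=\frac{R}{a}\cos(r)\cos(t),\qquad y=\frac{R}{a}\sin(r)\cos(t),\qquad z=R\sin(t),$$ $$r\in\left[-\frac12\cdot\frac{2\pi}{n},\ \left(-\frac12+n\right)\frac{2\pi}{n}\right],\qquad t\in\left[0,\frac{\pi}{2}\right],$$ where $a=a(r)$ is given by $$a=\cos\left(r-(i-1)\frac{2\pi}{n}\right)\quad\text{for } r\in\left[\left(-\frac12+(i-1)\right)\frac{2\pi}{n},\ \left(-\frac12+i\right)\frac{2\pi}{n}\right],\quad i=1,2,\ldots,n.$$ That is, $S_n$ is exactly the set of points $(x,y,z)$ obtained from these formulas as $(r,t)$ ranges over the stated parameter domain.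
   Context: Let $P_n$ be the (filled) regular $n$-gon in the $xy$-plane centred at the origin, with inscribed circle of radius $R$, positioned so that one of its sides is perpendicular to the positive $x$-axis and meets it at the point $(R,0,0)$, the midpoint of that side. Consider the prism $P_n\times[0,R]$ and the inverted pyramid inside it with apex at the origin and base the top face $P_n\times\{R\}$, whose section at height $z\in[0,R]$ is $\frac{z}{R}P_n$. The prism with the pyramid removed is cut by planes parallel to the $xy$-plane into $m$ slices of equal thickness. Each slice is replaced by a slab of the same thickness and the same volume, whose horizontal cross-section is a regular $n$-gon concentric with and homothetic to $P_n$ (with centre on the $z$-axis). The slabs are stacked in the same order, and the surface $S_n$ is the lateral surface of the limiting solid as $m\to\infty$. Explicitly, for each $z\in[0,R]$ the section of $S_n$ at height $z$ is the boundary of $\lambda(z)P_n$, with $\lambda(z)\ge 0$ determined by the equality of areas $\operatorname{area}(\lambda(z)P_n)=\operatorname{area}(P_n)-\operatorname{area}\left(\frac{z}{R}P_n\right)$. At $z=R$ the section is the single point $(0,0,R)$. *)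

(* Defs.v *)
From HB Require Import structures.
From mathcomp Require Import all_boot all_order all_algebra.
From mathcomp Require Import all_classical all_reals all_analysis.
From mathcomp Require Import ring lra.
Set Implicit Arguments.
Unset Strict Implicit.
Unset Printing Implicit Defensive.
Import Order.TTheory GRing.Theory Num.Theory.
Import numFieldNormedType.Exports.
Local Open Scope classical_set_scope.
Local Open Scope ring_scope.

Definition area (R : realType) : set (R * R) -> \bar R :=
  (@lebesgue_measure R \x @lebesgue_measure R)%E.

Definition boundary (T : topologicalType) (A : set T) : set T :=
  closure A `\` interior A.

Definition homothety (R : realType) (c : R) (A : set (R * R)) : set (R * R) :=
  [set (c * p.1, c * p.2) | p in A].

Definition vertex (R : realType) (n : nat) (rho theta : R) (k : nat) : R * R :=
  (rho * cos (theta + k%:R * (2 * pi / n%:R)),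
   rho * sin (theta + k%:R * (2 * pi / n%:R))).

(* Convex hull of the n vertices. *)
Definition regular_ngon (R : realType) (n : nat) (rho theta : R) :
    set (R * R) :=
  [set p | exists w : 'I_n -> R,
     [/\ forall k, 0 <= w k,
         \sum_k w k = 1,
         p.1 = \sum_k w k * (vertex n rho theta k).1 &
         p.2 = \sum_k w k * (vertex n rho theta k).2]].

(* Indices are read modulo n, since vertex n rho theta n is vertex 0. *)
Definition side (R : realType) (n : nat) (rho theta : R) (k : nat) :
    set (R * R) :=
  let u := vertex n rho theta k in
  let v := vertex n rho theta k.+1 in
  [set (line_path u.1 v.1 s, line_path u.2 v.2 s) | s in `[0, 1]].

Definition sqnorm (R : realType) (p : R * R) : R := p.1 ^+ 2 + p.2 ^+ 2.

(* The circle of radius r about the origin is tangent to every side: it meets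
   the side, and no point of the side is strictly inside the circle. *)
Definition inscribed_circle (R : realType) (n : nat) (rho theta r : R) : Prop :=
  forall k : nat,
    (exists2 p, side n rho theta k p & sqnorm p = r ^+ 2) /\
    (forall p, side n rho theta k p -> r ^+ 2 <= sqnorm p).

(* P is the filled regular n-gon centred at the origin with inscribed circle of
   radius r, one side of which is perpendicular to the x-axis and has midpoint
   (r, 0). *)
Definition base_polygon (R : realType) (n : nat) (r : R) (P : set (R * R)) :
    Prop :=
  exists rho theta : R,
    [/\ 0 < rho,
        P = regular_ngon n rho theta,
        inscribed_circle n rho theta r &
        exists k : nat,
          let u := vertex n rho theta k in
          let v := vertex n rho theta k.+1 in
          u.1 = v.1 /\ ((u.1 + v.1) / 2, (u.2 + v.2) / 2) = (r, 0)].

Definition slab_surface (R : realType) (r : R) (P : set (R * R)) :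
    set (R * R * R) :=
  [set p : R * R * R | let: (x, y, z) := p in
     0 <= z <= r /\
     exists lambda : R,
       [/\ 0 <= lambda,
           area (homothety lambda P) = (area P - area (homothety (z / r) P))%E &
           boundary (homothety lambda P) (x, y)]].

(* The n formulas agree at the common endpoints of consecutive intervals, and
   they determine a on the whole range of the parameter. *)
Definition piecewise_cos (R : realType) (n : nat) (a : R -> R) : Prop :=
  forall i : nat, (1 <= i <= n)%N ->
  forall r : R,
    (- 2^-1 + (i%:R - 1)) * (2 * pi / n%:R) <= r
      <= (- 2^-1 + i%:R) * (2 * pi / n%:R) ->
    a r = cos (r - (i%:R - 1) * (2 * pi / n%:R)).

Definition param_surface (R : realType) (n : nat) (rad : R) (a : R -> R) :
    set (R * R * R) :=
  [set p : R * R * R | exists r t : R,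
     [/\ - 2^-1 * (2 * pi / n%:R) <= r <= (- 2^-1 + n%:R) * (2 * pi / n%:R),
         0 <= t <= pi / 2 &
         p = (rad / a r * cos r * cos t,
              rad / a r * sin r * cos t,
              rad * sin t)]].

Lemma base_polygon_exists (R : realType) (n : nat) (r : R) :
  (3 <= n)%N -> 0 < r -> exists P : set (R * R), base_polygon n r P.
Proof.
move=> n3 r0.
have n0 : 0 < n%:R :> R by rewrite ltr0n; case: n n3.
have n3R : 3 <= n%:R :> R by rewrite (ler_nat R 3 n).
pose h : R := pi / n%:R.
have d2h : 2 * pi / n%:R = h + h :> R by rewrite /h; ring.
have h0 : 0 < h by rewrite divr_gt0 // pi_gt0.
have hlt : h < pi / 2.
  by rewrite /h ltr_pM2l ?pi_gt0 // ltf_pV2 ?posrE //; lra.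
have ch : 0 < cos h by apply: cos_gt0_pihalf; apply/andP; split; lra.
have cs x : cos x ^+ 2 + sin x ^+ 2 = 1 :> R by rewrite cos2Dsin2.
exists (regular_ngon n (r / cos h) (- h)), (r / cos h), (- h); split => //.
- by rewrite divr_gt0.
- have key k s :
      let u := vertex n (r / cos h) (- h) k in
      let v := vertex n (r / cos h) (- h) k.+1 in
      sqnorm (line_path u.1 v.1 s, line_path u.2 v.2 s)
      = r ^+ 2 + (r / cos h) ^+ 2 * sin h ^+ 2 * (1 - 2 * s) ^+ 2.
    rewrite /= d2h -natr1.
    set c := (- h + k%:R * (h + h) + h).
    have -> : - h + k%:R * (h + h) = c - h by rewrite /c; ring.
    have -> : - h + (k%:R + 1) * (h + h) = c + h by rewrite /c; ring.
    rewrite /sqnorm /line_path /= (cosB c h) (cosD c h) (sinB c h) (sinD c h).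
    have hc := cs c; have hh := cs h.
    set rho := r / cos h.
    have er : r = rho * cos h by rewrite /rho divfK // gt_eqF.
    rewrite er.
    transitivity ((rho ^+ 2 * cos h ^+ 2
      + rho ^+ 2 * sin h ^+ 2 * (1 - 2 * s) ^+ 2) * (cos c ^+ 2 + sin c ^+ 2)).
      by ring.
    by rewrite hc; ring.
  move=> k; split.
    eexists; first by exists 2^-1; [rewrite /= in_itv /=; lra | reflexivity].
    by rewrite key; field; rewrite gt_eqF.
  move=> _ [s _ <-]; rewrite key lerDl.
  by apply: mulr_ge0; [apply: mulr_ge0|]; exact: sqr_ge0.
- exists 0%N; rewrite /= d2h mul0r mul1r addr0.
  have -> : - h + (h + h) = h by ring.
  rewrite cosN sinN; split=> //; congr pair; last by ring.
  by field; rewrite gt_eqF.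
Qed.

(* Main.v *)
(* With w = 2 pi / n, the base polygon is the intersection of the half-planes
   x cos(i w) + y sin(i w) <= R, i < n. In polar coordinates (s, r), with r
   within w / 2 of i w, the i-th inequality implies all the others, so the
   boundary of lambda P_n is the curve s a(r) = lambda R, where a is the
   maximum of the functions cos(r - i w). Since areas scale by the square of
   the ratio, the equality of areas reads lambda^2 + (z / R)^2 = 1, that is
   lambda = cos t and z = R sin t. *)
Require Import Defs.
From mathcomp Require Import all_boot all_order all_algebra.
From mathcomp Require Import all_classical all_reals all_analysis.
From mathcomp Require Import measurable_realfun ring lra.
Import Order.TTheory GRing.Theory Num.Theory.
Import numFieldNormedType.Exports.
Local Open Scope classical_set_scope.
Local Open Scope ring_scope.

(** * Scaling of the area *)

Lemma homothetyE (R : realType) (c : R) (A : set (R * R)) : 0 < c ->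
  homothety c A = (fun p : R * R => (c^-1 * p.1, c^-1 * p.2)) @^-1` A.
Proof.
move=> c0; have cn0 : c != 0 by rewrite gt_eqF.
apply/seteqP; split=> [_ [[x y] Axy <-]|[x y] Axy] /=; first by rewrite !mulKf.
by exists (c^-1 * x, c^-1 * y) => //=; rewrite !mulVKf.
Qed.

Lemma measurable_scale (R : realType) (c : R) :
  measurable_fun [set: measurableTypeR R]
    ( *%R c : measurableTypeR R -> measurableTypeR R).
Proof. exact: mulrl_measurable. Qed.

(** By uniqueness of Lebesgue measure: the pushforward under multiplication by [c^-1], rescaled by
    [c^-1], gives every half-open interval its length. *)
Lemma lebesgue_measure_scale (R : realType) (c : R)
    (A : set (measurableTypeR R)) : 0 < c -> measurable A ->
  lebesgue_measure ( *%R c^-1 @^-1` A) = (c%:E * lebesgue_measure A)%E.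
Proof.
move=> c0 mA; have cV0 : 0 < c^-1 by rewrite invr_gt0.
pose mu := mscale (NngNum (ltW cV0))
  (pushforward lebesgue_measure
     ( *%R c^-1 : measurableTypeR R -> measurableTypeR R)).
have mf := measurable_scale R c^-1.
have muE B : mu mf B = (c^-1%:E * lebesgue_measure ( *%R c^-1 @^-1` B))%E by [].
suff -> : lebesgue_measure A = mu mf A.
  by rewrite muE muleA -EFinM mulfV ?gt_eqF// mul1e.
apply: lebesgue_measure_unique => // _ [[a b]] _ <-.
rewrite [RHS]muE.
have -> : *%R c^-1 @^-1` `]a, b]%classic = `]c * a, c * b]%classic.
  by apply/seteqP; split=> x /=; rewrite !in_itv /= ltr_pdivlMl// ler_pdivrMl.
rewrite !lebesgue_measure_itv /= !lte_fin ltr_pM2l//.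
case: ifP => _; last by rewrite mule0.
by rewrite -!EFinD -EFinM; congr EFin; field; rewrite gt_eqF.
Qed.

(** The same argument in the plane: by uniqueness of the product measure it suffices to test
    rectangles, where each side contributes a factor [c]. *)
Lemma area_homothety (R : realType) (c : R) (A : set (R * R)) : 0 < c ->
  measurable (A : set (measurableTypeR R * measurableTypeR R)) ->
  area (homothety c A) = ((c ^+ 2)%:E * area A)%E.
Proof.
move=> c0 mA; have cV0 : 0 <= c^-1 ^+ 2 by rewrite sqr_ge0.
have cn0 : c != 0 by rewrite gt_eqF.
rewrite homothetyE//.
set f : measurableTypeR R * measurableTypeR R ->
  measurableTypeR R * measurableTypeR R :=
  fun p : R * R => (c^-1 * p.1, c^-1 * p.2).
have mf : measurable_fun setT f.
  by apply: measurable_fun_pair => /=;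
    apply: measurableT_comp => //; exact: measurable_scale.
pose mu := mscale (NngNum cV0) (pushforward
  (@lebesgue_measure R \x @lebesgue_measure R)%E f).
have muE B : mu mf B = ((c^-1 ^+ 2)%:E * area (f @^-1` B))%E by [].
suff -> : area A = mu mf A.
  by rewrite muE muleA -EFinM -exprMn mulfV// expr1n mul1e.
apply: product_measure_unique => // B C mB mC.
rewrite [LHS]muE.
have -> : f @^-1` (B `*` C) = ( *%R c^-1 @^-1` B) `*` ( *%R c^-1 @^-1` C) by [].
rewrite /area product_measure1E; last 2 first.
- by rewrite -[X in measurable X]setTI; exact: measurable_scale.
- by rewrite -[X in measurable X]setTI; exact: measurable_scale.
rewrite /= (lebesgue_measure_scale _ _ _ c0 mB)
  (lebesgue_measure_scale _ _ _ c0 mC) muleACA -EFinM !muleA -EFinM.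
rewrite (_ : c^-1 ^+ 2 * (c * c) = 1) ?mul1e//; by field.
Qed.

(** Serves the ratio 0, where the polygon collapses to its centre. *)
Lemma area_singleton (R : realType) (p : R * R) : area [set p] = 0%E.
Proof.
have -> : [set p] = [set p.1] `*` [set p.2].
  by apply/seteqP; split=> [_ ->|[x y] [/= -> ->]] //; case: p.
by rewrite /area product_measure1E //= !lebesgue_measure_set1 mule0.
Qed.

(** * The polygon as an intersection of half-planes *)

Definition step (R : realType) (n : nat) : R := 2 * pi / n%:R.

Section step.
Variables (R : realType) (n : nat).
Hypothesis n3 : (3 <= n)%N.
Local Notation w := (step R n).

Lemma n_step : n%:R * w = 2 * pi.
Proof.
by rewrite /step mulrC divfK// pnatr_eq0 -lt0n (leq_trans _ n3).
Qed.

Lemma step_gt0 : 0 < w.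
Proof.
rewrite /step divr_gt0 ?mulr_gt0 ?pi_gt0// ltr0n; exact: leq_trans n3.
Qed.

Lemma step_ltpi : w < pi.
Proof.
have n3R : 3 <= n%:R :> R by rewrite (ler_nat R 3 n).
rewrite /step ltr_pdivrMr; last by lra.
by rewrite mulrC ltr_pM2l ?pi_gt0//; lra.
Qed.

Lemma cos_step_gt0 : 0 < cos (w / 2).
Proof.
have := step_gt0; have := step_ltpi => *.
by apply: cos_gt0_pihalf; apply/andP; split; lra.
Qed.

Lemma sin_step_gt0 : 0 < sin (w / 2).
Proof.
have := step_gt0; have := step_ltpi => *.
by apply: sin_gt0_pi; apply/andP; split; lra.
Qed.

End step.

(** * Comparison of cosines and covering by angular sectors *)

Lemma ler_cos_pi (R : realType) (x y : R) :
  0 <= x -> x <= y -> y <= pi -> cos y <= cos x.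
Proof.
move=> x0 xy ypi; have [->|xny] := eqVneq x y; first by [].
by rewrite ltW// ltr_cos ?in_itv/= ?x0 ?ypi ?(le_trans x0)//
  ?(le_trans xy)// lt_neqAle xny.
Qed.

Lemma ler_cos_norm (R : realType) (x y : R) :
  `|x| <= y -> y <= pi -> cos y <= cos x.
Proof. by move=> xy ypi; rewrite -(cos_norm x); exact: ler_cos_pi. Qed.

Lemma cosB2pi (R : realType) (x : R) : cos (2 * pi - x) = cos x.
Proof. by rewrite -cosN opprB mulr_natl -{2}(subrK (pi *+ 2) x) cosD2pi. Qed.

(** Cosine is symmetric about [pi], so on [[y, 2 * pi - y]] it is largest at the endpoints. *)
Lemma ler_cos_away (R : realType) (x y : R) :
  0 <= y -> y <= `|x| -> `|x| <= 2 * pi - y -> cos x <= cos y.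
Proof.
move=> y0 yx xy; rewrite -(cos_norm x).
have [xpi|pix] := leP `|x| pi; first exact: ler_cos_pi.
by rewrite -cosB2pi; apply: ler_cos_pi; lra.
Qed.

Lemma sector_exists (R : realType) (w t : R) (n : nat) : (0 < n)%N ->
  - (w / 2) <= t -> t <= n%:R * w - w / 2 ->
  exists2 i, (i < n)%N & `|t - i%:R * w| <= w / 2.
Proof.
elim: n => // n IHn _ tlo thi.
have [tle|tgt] := leP t (n%:R * w - w / 2).
  have [n0|n0] := posnP n.
    exists 0%N => //; rewrite n0 mul1r in thi.
    by rewrite mul0r subr0 ler_norml tlo /=; lra.
  by have [i iln ti] := IHn n0 tlo tle; exists i => //; exact: ltnW.
exists n => //; rewrite -natr1 in thi.
by rewrite ler_norml; apply/andP; split; lra.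
Qed.

Section polygon.
Variables (R : realType) (n : nat).
Hypothesis n3 : (3 <= n)%N.
Local Notation w := (step R n).

(** The inner product with the unit outward normal of side [i]. *)
Definition side_form (i : nat) (p : R * R) : R :=
  p.1 * cos (i%:R * w) + p.2 * sin (i%:R * w).

Definition polygon (c : R) : set (R * R) :=
  [set p | forall i, (i < n)%N -> side_form i p <= c].

Lemma side_form_polar i (s t : R) :
  side_form i (s * cos t, s * sin t) = s * cos (t - i%:R * w).
Proof. by rewrite /side_form cosB /=; ring. Qed.

Lemma side_formZ i (c : R) p :
  side_form i (c * p.1, c * p.2) = c * side_form i p.
Proof. by rewrite /side_form /=; ring. Qed.

(** For [j] other than [i], the centres [i w] and [j w] differ by at least [w] and at most
    [2 pi - w]. Hence [t] is at least [w / 2] away from [j w] modulo a full turn, and [cos (w / 2)]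
    separates the two cosines. *)
Lemma sector_max (t : R) i j : (i < n)%N -> (j < n)%N ->
  `|t - i%:R * w| <= w / 2 -> cos (t - j%:R * w) <= cos (t - i%:R * w).
Proof.
move=> iln jln ti; have w0 := step_gt0 R n n3; have wpi := step_ltpi R n n3.
have [->//|ij] := eqVneq j i.
apply: (@le_trans _ _ (cos (w / 2))); last by apply: ler_cos_norm => //; lra.
have nw := n_step R n n3.
move: ti; rewrite ler_norml => /andP[ti1 ti2].
have gap (a b : nat) : (a < b)%N -> (b < n)%N -> w <= b%:R * w - a%:R * w /\
    b%:R * w - a%:R * w <= 2 * pi - w.
  move=> ab bn; have : a%:R + 1 <= b%:R :> R by rewrite natr1 ler_nat.
  have : b%:R + 1 <= n%:R :> R by rewrite natr1 ler_nat.
  have a0 : 0 <= a%:R :> R by [].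
  rewrite -nw => h1 h2; split; first by nra.
  nra.
apply: ler_cos_away; first lra.
  case: (ltngtP i j) ij => // [ilj|jli] _.
    by have [h1 h2] := gap _ _ ilj jln; rewrite ler0_norm; lra.
  by have [h1 h2] := gap _ _ jli iln; rewrite ger0_norm; lra.
case: (ltngtP i j) ij => // [ilj|jli] _.
  by have [h1 h2] := gap _ _ ilj jln; rewrite ler0_norm; lra.
by have [h1 h2] := gap _ _ jli iln; rewrite ger0_norm; lra.
Qed.

Lemma cos_sector_gt0 (t : R) i :
  `|t - i%:R * w| <= w / 2 -> 0 < cos (t - i%:R * w).
Proof.
move=> ti; apply: lt_le_trans (cos_step_gt0 R n n3) _.
apply: ler_cos_norm => //.
have := step_gt0 R n n3; have := step_ltpi R n n3; lra.
Qed.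

(** The angle is normalised to start at [- (w / 2)], as in the parameter domain of the surface. *)
Lemma polar_exists (x y : R) : exists s t : R,
  [/\ 0 <= s, - (w / 2) <= t <= n%:R * w - w / 2,
      x = s * cos t & y = s * sin t].
Proof.
have w0 := step_gt0 R n n3; have wpi := step_ltpi R n n3.
rewrite n_step//.
pose s := Num.sqrt (x ^+ 2 + y ^+ 2).
have s2 : s ^+ 2 = x ^+ 2 + y ^+ 2 by rewrite sqr_sqrtr// addr_ge0 ?sqr_ge0.
have [s0|sn0] := eqVneq s 0.
  exists 0, 0; rewrite lexx; split=> //; first by apply/andP; split; lra.
    by move: s2; rewrite s0; nra.
  by move: s2; rewrite s0; nra.
have sp : 0 < s by rewrite lt_neqAle eq_sym sn0 sqrtr_ge0.
have xs : -1 <= x / s <= 1.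
  by rewrite ler_pdivlMr// ler_pdivrMr//; apply/andP; split; nra.
pose u := acos (x / s).
have cu : cos u = x / s by rewrite acosK ?in_itv.
have u0 : 0 <= u := acos_ge0 xs.
have upi : u <= pi := acos_lepi xs.
have su : 0 <= sin u by apply: sin_ge0_pi; rewrite u0 upi.
have su2 : (s * sin u) ^+ 2 = y ^+ 2.
  by rewrite exprMn sin2cos2 cu exprMn exprVn s2; field; rewrite -s2 expf_neq0.
have xE : x = s * cos u by rewrite cu mulrC divfK.
have [y0|y0] := leP 0 y.
  exists s, u; split=> //; [exact: ltW|by apply/andP; split; lra|].
  by apply/eqP; rewrite -(eqrXn2 (n:=2))// ?su2// mulr_ge0// ltW.
have yE : y = s * sin (- u).
  apply: oppr_inj; rewrite sinN mulrN opprK.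
  apply/eqP; rewrite -(eqrXn2 (n:=2))// ?su2 ?sqrrN//;
    last by rewrite mulr_ge0// ltW.
  lra.
(* The angle [- u] lies in [[- pi, 0]]; below [- (w / 2)] it needs a full turn. *)
have [ulo|uhi] := leP (- (w / 2)) (- u).
  exists s, (- u); rewrite cosN; split=> //; first exact: ltW.
  by apply/andP; split; lra.
exists s, (- u + pi *+ 2); rewrite cosD2pi sinD2pi cosN; split=> //.
  exact: ltW.
by rewrite -mulr_natl; apply/andP; split; lra.
Qed.

Lemma polygon_sector (c s t : R) i : 0 <= s -> (i < n)%N ->
  `|t - i%:R * w| <= w / 2 ->
  polygon c (s * cos t, s * sin t) <-> s * cos (t - i%:R * w) <= c.
Proof.
move=> s0 iln ti; split=> [/(_ i iln)|le_c j jln]; rewrite side_form_polar//.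
by apply: le_trans le_c; rewrite ler_wpM2l//; exact: sector_max.
Qed.

Lemma sectorP (p : R * R) : exists s t : R, exists i : nat,
  [/\ 0 <= s, - (w / 2) <= t <= n%:R * w - w / 2, p = (s * cos t, s * sin t),
      (i < n)%N & `|t - i%:R * w| <= w / 2].
Proof.
case: p => x y.
have [s [t [s0 /[dup] trg /andP[t1 t2] -> ->]]] := polar_exists x y.
have n0 : (0 < n)%N by exact: leq_trans n3.
have [i iln ti] := sector_exists R w t n n0 t1 t2.
by exists s, t, i.
Qed.

Lemma polygon0 : polygon 0 = [set (0, 0)].
Proof.
apply/seteqP; split=> [p|_ -> i _]; last by rewrite /side_form/= !mul0r addr0.
have [s [t [i [s0 _ -> iln ti]]]] := sectorP p.
move=> /(polygon_sector _ _ _ _ s0 iln ti).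
rewrite pmulr_lle0; last exact: cos_sector_gt0.
move=> s1; have -> : s = 0 by lra.
by rewrite !mul0r.
Qed.

Lemma homothety_polygon (c r : R) : 0 <= c -> 0 <= r ->
  homothety c (polygon r) = polygon (c * r).
Proof.
(* Ratio 0 is separate because the scaling is then not invertible. *)
move=> c0 r0; have [->|cn0] := eqVneq c 0.
  rewrite mul0r polygon0; apply/seteqP; split=> [_ [p _ <-]|_ ->].
    by rewrite !mul0r.
  exists (0, 0); last by rewrite /= !mul0r.
  by move=> i _; rewrite /side_form/= !mul0r addr0.
have cp : 0 < c by rewrite lt_neqAle eq_sym cn0.
apply/seteqP; split=> [_ [p pP <-] i iln|[x y] pP].
  by rewrite side_formZ ler_pM2l//; exact: pP.
exists (c^-1 * x, c^-1 * y); last by rewrite /= !mulVKf.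
move=> i iln; rewrite -(ler_pM2l cp) -side_formZ /= !mulVKf//; exact: pP.
Qed.

Lemma continuous_side_form i : continuous (side_form i).
Proof.
move=> p; apply: cvgD; apply: cvgM;
  by [exact: cvg_fst|exact: cvg_snd|exact: cvg_cst].
Qed.

(** The polygon is closed, and finitely many strict inequalities persist on a neighbourhood, so a
    boundary point turns one of them into an equality. *)
Lemma boundary_polygon (c : R) : boundary (polygon c) =
  [set p | polygon c p /\ exists2 i, (i < n)%N & side_form i p = c].
Proof.
apply/seteqP; split=> p.
  move=> [clp nip].
  have pP : polygon c p.
    move=> i iln.
    have cli : closed (side_form i @^-1` [set x | x <= c]).
      apply: closed_comp (@closed_le _ c) => ? _; exact: continuous_side_form.
    move: clp; rewrite closureE => /(_ (side_form i @^-1` [set x | x <= c])).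
    apply.
    by split=> // z zP; exact: zP.
  split=> //; apply: contrapT => /forall2NP noteq; apply: nip.
  have lt_c i : (i < n)%N -> side_form i p < c.
    by move=> iln; rewrite lt_neqAle pP// andbT; apply/eqP; have [] := noteq i.
  suff : \forall q \near p, forall i : 'I_n, side_form i q < c.
    by apply: filterS => q qlt i iln; apply/ltW/(qlt (Ordinal iln)).
  apply: (@filter_forall _ _ (fun i : 'I_n => [set q | side_form i q < c])
    (nbhs p)).
  move=> i.
  have op : open (side_form i @^-1` [set x | x < c]).
    by apply: open_comp (@open_lt _ c) => ? _; exact: continuous_side_form.
  exact: (open_nbhs_nbhs (conj op (lt_c i (ltn_ord i)))).
move=> [pP [i iln pc]]; split; first exact: subset_closure.
move=> /nbhs_ballP[e /= e0 bP].
(* Moving by [e / 2] along the normal raises [side_form i] by [e / 2]: [q] is in the ball but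
   outside the polygon. *)
pose q := (p.1 + e / 2 * cos (i%:R * w), p.2 + e / 2 * sin (i%:R * w)).
have /bP /(_ i iln) : ball p e q.
  have b (x u : R) : -1 <= u <= 1 -> ball x e (x + e / 2 * u).
    move=> /andP[u1 u2]; rewrite /ball /= opprD addNKr normrN ltr_norml.
    by apply/andP; split; nra.
  by split=> /=; apply: b; rewrite ?cos_geN1 ?cos_le1 ?sin_geN1 ?sin_le1.
have := cos2Dsin2 (i%:R * w); rewrite -pc /side_form /=; nra.
Qed.

End polygon.

(** * Convex hull of the vertices *)

Lemma cosDn2pi (R : realType) (x : R) (q : nat) :
  cos (x + q%:R * (2 * pi)) = cos x.
Proof.
have -> : q%:R * (2 * pi) = (pi *+ 2) *+ q :> R by rewrite mulr_natl mulr_natl.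
by rewrite periodicn//; exact: cosD2pi.
Qed.

Lemma sinDn2pi (R : realType) (x : R) (q : nat) :
  sin (x + q%:R * (2 * pi)) = sin x.
Proof. by rewrite -!cosBpihalf addrAC cosDn2pi. Qed.

Section regular_ngon.
Variables (R : realType) (n : nat).
Hypothesis n3 : (3 <= n)%N.
Local Notation w := (step R n).

Lemma vertexDn (rho theta : R) (j q : nat) :
  vertex n rho theta (j + q * n) = vertex n rho theta j.
Proof.
rewrite /vertex -/(step R n) natrD natrM mulrDl -mulrA n_step// addrA.
by rewrite cosDn2pi sinDn2pi.
Qed.

(** Convexity for three points, to be applied to two adjacent vertices and the centre. *)
Lemma regular_ngon_comb3 (rho theta a b c : R) (p q r : R * R) :
  0 <= a -> 0 <= b -> 0 <= c -> a + b + c = 1 ->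
  regular_ngon n rho theta p -> regular_ngon n rho theta q ->
  regular_ngon n rho theta r ->
  regular_ngon n rho theta
    (a * p.1 + b * q.1 + c * r.1, a * p.2 + b * q.2 + c * r.2).
Proof.
move=> a0 b0 c0 abc [u [u0 u1 px py]] [v [v0 v1 qx qy]] [z [z0 z1 rx ry]].
exists (fun k => a * u k + b * v k + c * z k); split=> [k|||] /=.
- by rewrite !addr_ge0// mulr_ge0.
- by rewrite !big_split/= -!mulr_sumr u1 v1 z1 !mulr1.
- rewrite px qx rx !mulr_sumr -!big_split /=; apply: eq_bigr => k _; ring.
- rewrite py qy ry !mulr_sumr -!big_split /=; apply: eq_bigr => k _; ring.
Qed.

Lemma regular_ngon_vertex (rho theta : R) (j : nat) :
  regular_ngon n rho theta (vertex n rho theta j).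
Proof.
have n0 : (0 < n)%N by exact: leq_trans n3.
rewrite (divn_eq j n) addnC vertexDn.
pose i := Ordinal (ltn_pmod j n0).
exists (fun k => (k == i)%:R); split=> [k|||] //.
- by rewrite (bigD1 i)//= eqxx big1 ?addr0// => k /negbTE ->.
- rewrite (bigD1 i)//= eqxx mul1r big1 ?addr0// => k /negbTE ->.
  by rewrite mul0r.
- rewrite (bigD1 i)//= eqxx mul1r big1 ?addr0// => k /negbTE ->.
  by rewrite mul0r.
Qed.

(* Multiplying by 2 sin (w / 2) makes the sum telescope. *)
Lemma sum_cos_eq0 (t : R) : \sum_(k < n) cos (t + k%:R * w) = 0.
Proof.
have tel m : (\sum_(k < m) cos (t + k%:R * w)) * (2 * sin (w / 2)) =
    sin (t - w / 2 + m%:R * w) - sin (t - w / 2).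
  elim: m => [|m IHm]; first by rewrite big_ord0 !mul0r addr0 subrr.
  rewrite big_ord_recr /= mulrDl IHm -[m.+1%:R]natr1.
  have -> : t - w / 2 + (m%:R + 1) * w = t + m%:R * w + w / 2 by field.
  have -> : t - w / 2 + m%:R * w = t + m%:R * w - w / 2 by field.
  by rewrite (sinB (t + _)) (sinD (t + _) (w / 2)); ring.
have := tel n; rewrite n_step// -[2 * pi]mul1r (sinDn2pi _ _ 1) subrr.
move/eqP; rewrite mulf_eq0 => /orP[/eqP//|].
by rewrite mulf_eq0 pnatr_eq0/= gt_eqF// sin_step_gt0.
Qed.

(** The centre is the mean of the vertices; sines reduce to cosines by a quarter turn. *)
Lemma regular_ngon0 (rho theta : R) : regular_ngon n rho theta (0, 0).
Proof.
exists (fun=> n%:R^-1); split=> //=.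
- rewrite sumr_const card_ord -(mulr_natl n%:R^-1) mulfV//.
  by rewrite pnatr_eq0 -lt0n (leq_trans _ n3).
- by rewrite -mulr_sumr -mulr_sumr sum_cos_eq0 !mulr0.
- rewrite -mulr_sumr -mulr_sumr.
  under eq_bigr do rewrite -cosBpihalf addrAC.
  by rewrite sum_cos_eq0 !mulr0.
Qed.

(** Modulo a full turn, an odd multiple of [w / 2] stays at least [w / 2] away from 0. *)
Lemma ler_cos_odd (m : nat) : cos (m%:R * w - w / 2) <= cos (w / 2).
Proof.
have w0 := step_gt0 R n n3; have wpi := step_ltpi R n n3.
have n0 : (0 < n)%N by exact: leq_trans n3.
rewrite {1}(divn_eq m n) natrD natrM mulrDl -mulrA n_step// -addrA
  addrC cosDn2pi.
have := ltn_pmod m n0; case: (m %% n)%N => [_|m' m'n].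
  by rewrite mul0r add0r cosN.
have : 1 <= m'.+1%:R :> R by rewrite (ler_nat R 1).
have : m'.+1%:R + 1 <= n%:R :> R by rewrite natr1 ler_nat.
have := n_step R n n3.
move: (m'.+1%:R) => M nw M1 M2.
by apply: ler_cos_away; rewrite ?ger0_norm; nra.
Qed.

Lemma side_form_vertex_le (rho : R) (i m : nat) : 0 <= rho -> (i < n)%N ->
  side_form R n i (rho * cos (m%:R * w - w / 2), rho * sin (m%:R * w - w / 2))
    <= rho * cos (w / 2).
Proof.
move=> rho0 iln; rewrite side_form_polar ler_wpM2l//.
(* Adding [n] keeps the natural subtraction exact and costs one full turn. *)
have := ler_cos_odd (m + n - i)%N; apply: le_trans.
rewrite natrB ?natrD; last by rewrite (leq_trans (ltnW iln))// leq_addl.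
rewrite -[leLHS](cosDn2pi _ _ 1) mul1r -(n_step R n n3).
by rewrite le_eqVlt; apply/orP; left; apply/eqP; congr cos; ring.
Qed.

(** The side with midpoint [(r, 0)] fixes the rotation and gives [rho * cos (w / 2) = r]. Vertices
    then satisfy all the inequalities; conversely, a point in sector [i] lies in the triangle
    spanned by the centre and the ends of side [i]. *)
Lemma base_polygonE (r : R) (P : set (R * R)) : 0 < r ->
  base_polygon n r P -> P = polygon R n r.
Proof.
move=> r0 [rho [theta [rho0 -> _ [k [/= + [+ _]]]]]].
rewrite -/(step R n) -natr1.
have w0 := step_gt0 R n n3; have wpi := step_ltpi R n n3.
have C0 := cos_step_gt0 R n n3; have S0 := sin_step_gt0 R n n3.
set C := cos (w / 2) in C0; set S := sin (w / 2) in S0.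
(* The direction of the midpoint of the vertical side. *)
pose psi := theta + k%:R * w + w / 2.
have -> : theta + k%:R * w = psi - w / 2 by rewrite /psi; ring.
have -> : theta + (k%:R + 1) * w = psi + w / 2 by rewrite /psi; field.
rewrite cosB cosD -/C -/S => e1 e2.
have spsi : sin psi = 0.
  have : rho * S * sin psi = 0 by lra.
  by move/eqP; rewrite mulf_eq0 gt_eqF ?mulr_gt0//= => /eqP.
have rE : rho * C * cos psi = r by lra.
have cpsi : cos psi = 1.
  have cp : 0 < cos psi by rewrite -(pmulr_rgt0 _ (mulr_gt0 rho0 C0)) rE.
  by have := cos2Dsin2 psi; rewrite spsi; nra.
rewrite cpsi mulr1 in rE.
(* Counted from [k], vertices [i] and [i + 1] are the ends of the side with normal angle [i w]. *)
have vE m : vertex n rho theta (k + m) =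
    (rho * cos (m%:R * w - w / 2), rho * sin (m%:R * w - w / 2)).
  rewrite /vertex -/(step R n) natrD.
  have -> : theta + (k%:R + m%:R) * w = psi + (m%:R * w - w / 2).
    by rewrite /psi; ring.
  by rewrite cosD sinD spsi cpsi !mul1r !mul0r subr0 add0r.
apply/seteqP; split=> [p [a [a0 a1 px py]] i iln|p pP].
  have -> : side_form R n i p =
      \sum_j a j * side_form R n i (vertex n rho theta j).
    rewrite /side_form px py !mulr_suml -big_split /=.
    by apply: eq_bigr => j _; ring.
  rewrite -rE -[leRHS]mul1r -a1 mulr_suml; apply: ler_sum => j _.
  rewrite ler_wpM2l//.
  have n0 : (0 < n)%N by exact: leq_trans n3.
  (* Adding [k] full turns brings the index [j] to the form [k + m]. *)
  rewrite -(vertexDn _ _ j k).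
  have -> : (j + k * n = k + (j + k * n.-1))%N.
    by rewrite addnCA -mulnS prednK.
  by rewrite vE side_form_vertex_le// ltW.
have [s [t [i [s0 _ pE iln ti]]]] := sectorP R n n3 p.
move: pP; rewrite pE => /(polygon_sector _ _ n3 _ _ _ _ s0 iln ti).
set d := t - i%:R * w; rewrite -rE => sd.
have /andP[d1 d2] : - (w / 2) <= d <= w / 2 by rewrite -ler_norml.
have tE : t = i%:R * w + d by rewrite /d addrC subrK.
clearbody d.
(* [Sm] and [Sp] say that [sin (w / 2 - d)] and [sin (w / 2 + d)] are nonnegative; these are the
   barycentric weights up to a common factor. *)
have Sm : 0 <= S * cos d - C * sin d.
  by rewrite /S /C -sinB sin_ge0_pi//; apply/andP; split; lra.
have Sp : 0 <= S * cos d + C * sin d.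
  by rewrite /S /C -sinD sin_ge0_pi//; apply/andP; split; lra.
have D0 : 0 < 2 * rho * S * C by rewrite !mulr_gt0.
have Cn0 : C != 0 by rewrite gt_eqF.
have Sn0 : S != 0 by rewrite gt_eqF.
have rhon0 : rho != 0 by rewrite gt_eqF.
(* [p] is [a] times vertex [i] plus [b] times vertex [i + 1]. *)
pose a := s * (S * cos d - C * sin d) / (2 * rho * S * C).
pose b := s * (S * cos d + C * sin d) / (2 * rho * S * C).
have a0 : 0 <= a by rewrite divr_ge0 ?mulr_ge0// ltW.
have b0 : 0 <= b by rewrite divr_ge0 ?mulr_ge0// ltW.
have abE : a + b = s * cos d / (rho * C).
  by rewrite /a /b; field; rewrite Cn0 Sn0 rhon0.
(* The inequality of side [i] says exactly [a + b <= 1]; the centre takes the remaining weight. *)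
have ab1 : 0 <= 1 - (a + b).
  by rewrite subr_ge0 abE ler_pdivrMr ?mul1r// mulr_gt0.
have := regular_ngon_comb3 rho theta a b (1 - (a + b)) _ _ _ a0 b0 ab1
  (subrKC _ _) (regular_ngon_vertex rho theta (k + i))
  (regular_ngon_vertex rho theta (k + i.+1)) (regular_ngon0 rho theta).
rewrite !vE -[i.+1%:R]natr1 /= !mulr0 !addr0.
have -> : (i%:R + 1) * w - w / 2 = i%:R * w + w / 2 by field.
rewrite tE !(cosB (i%:R * w) (w / 2)) !(sinB (i%:R * w) (w / 2)) !cosD !sinD.
rewrite -/C -/S; congr (regular_ngon _ _ _ (_, _)).
  by rewrite /a /b; field; rewrite Cn0 Sn0 rhon0.
by rewrite /a /b; field; rewrite Cn0 Sn0 rhon0.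
Qed.

End regular_ngon.

(** * Area of the polygon and the equation for the ratio *)

Section polygon_area.
Variables (R : realType) (n : nat).
Hypothesis n3 : (3 <= n)%N.
Local Notation w := (step R n).

Lemma measurable_polygon (c : R) :
  measurable (polygon R n c : set (measurableTypeR R * measurableTypeR R)).
Proof.
have -> : polygon R n c = \bigcap_(i in `I_n) [set p | side_form R n i p <= c].
  by apply/seteqP; split=> p pP i; exact: pP.
apply: bigcap_measurable => [|i _]; first by exists 0%N;
  rewrite /= (leq_trans _ n3).
rewrite -[X in measurable X]setTI; apply: measurable_fun_le => //.
by apply: measurable_funD; apply: measurable_funM => //; exact: measurable_cst.
Qed.

(** A square of side [c / 2] fits inside, and a square whose half-side is the circumradius contains
    the polygon. A positive finite area can be cancelled from the equality of areas. *)
Lemma polygon_area (c : R) : 0 < c ->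
  exists2 A : R, 0 < A & area (polygon R n c) = A%:E.
Proof.
move=> c0.
pose sq (x y : R) : set (R * R) := `[x, y]%classic `*` `[x, y]%classic.
have msq x y :
    measurable (sq x y : set (measurableTypeR R * measurableTypeR R)).
  by apply: measurableX; exact: measurable_itv.
have areasq (x y : R) : x < y -> area (sq x y) = ((y - x) ^+ 2)%:E.
  move=> xy; rewrite /area product_measure1E//.
  by rewrite /= !lebesgue_measure_itv /= lte_fin xy -!EFinD -EFinM.
have lo : (area (sq 0%R (c / 2)%R) <= area (polygon R n c))%E.
  apply: le_measure; rewrite ?inE //; first exact: measurable_polygon.
  move=> [x y] [] /=; rewrite !in_itv /= => /andP[x1 x2] /andP[y1 y2] i _.
  rewrite /side_form /=.
  have := cos_le1 (i%:R * w); have := sin_le1 (i%:R * w); nra.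
have C0 := cos_step_gt0 R n n3.
pose M := c / cos (w / 2).
have M0 : 0 < M by rewrite divr_gt0.
have hi : (area (polygon R n c) <= area (sq (- M)%R M))%E.
  apply: le_measure; rewrite ?inE //; first exact: measurable_polygon.
  move=> p; have [s [t [i [s0 _ -> iln ti]]]] := sectorP R n n3 p.
  move=> /(polygon_sector _ _ n3 _ _ _ _ s0 iln ti) sc.
  have sM : s <= M.
    rewrite ler_pdivlMr//; apply: le_trans sc; rewrite ler_wpM2l//.
    apply: ler_cos_norm => //.
    by have := step_gt0 R n n3; have := step_ltpi R n n3; lra.
  have := cos_le1 t; have := sin_le1 t; have := cos_geN1 t; have := sin_geN1 t.
  by move=> *; split; rewrite /= in_itv /=; apply/andP; split; nra.
rewrite areasq ?divr_gt0// subr0 in lo.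
rewrite areasq ?gtrN// in hi.
move: lo hi; case: (area _) => // A; rewrite !lee_fin => lo _.
exists A => //; apply: lt_le_trans lo; rewrite exprn_gt0// divr_gt0//.
Qed.

Lemma area_homothety_polygon (c r : R) : 0 <= c -> 0 < r ->
  area (homothety c (polygon R n r)) = ((c ^+ 2)%:E * area (polygon R n r))%E.
Proof.
move=> c0 r0; have [->|cn0] := eqVneq c 0.
  rewrite homothety_polygon// ?ltW// mul0r polygon0// area_singleton.
  by rewrite expr0n /= mul0e.
apply: area_homothety; first by rewrite lt_neqAle eq_sym cn0.
exact: measurable_polygon.
Qed.

Lemma area_eqP (r z lambda : R) : 0 < r -> 0 <= z -> 0 <= lambda ->
  area (homothety lambda (polygon R n r)) =
    (area (polygon R n r) - area (homothety (z / r) (polygon R n r)))%E <->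
  lambda ^+ 2 = 1 - (z / r) ^+ 2.
Proof.
move=> r0 z0 l0; rewrite !area_homothety_polygon ?divr_ge0// ?ltW//.
have [A A0 ->] := polygon_area r r0.
rewrite -!EFinM -EFinB; split=> [[e]|->]; last by congr EFin; ring.
by apply: (mulIf (lt0r_neq0 A0)); rewrite e; ring.
Qed.

End polygon_area.

(** * The function [a] as a maximum of cosines *)

Section sector_cos.
Variables (R : realType) (n : nat).
Hypothesis n3 : (3 <= n)%N.
Local Notation w := (step R n).

(** The maximum selects the sector, so shared endpoints need no choice; the default [-1] bounds
    cosine from below and never alters the value. *)
Definition sector_cos (t : R) : R :=
  \big[Num.max/-1]_(i < n) cos (t - i%:R * w).

Lemma sector_cosE (t : R) i : (i < n)%N ->
  `|t - i%:R * w| <= w / 2 -> sector_cos t = cos (t - i%:R * w).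
Proof.
move=> iln ti; apply/le_anti/andP; split.
  by apply: bigmax_le => [|j _]; [exact: cos_geN1|exact: sector_max].
exact: (le_bigmax _ _ (Ordinal iln)).
Qed.

Lemma piecewise_cos_sector_cos : piecewise_cos n sector_cos.
Proof.
(* Pieces are numbered from 1, sectors from 0. *)
move=> [//|i] /andP[_ iln] t.
rewrite -/(step R n) -[i.+1%:R]natr1 addrK => /andP[t1 t2].
by apply: sector_cosE => //; rewrite ler_norml; apply/andP; split; lra.
Qed.

End sector_cos.

(** * Equality of the slab surface and the parametrised surface *)

Theorem theorem5p1 (R : realType) (n : nat) (rad : R) (P : set (R * R))
  (hn : (3 <= n)%N) (hrad : 0 < rad) (hP : base_polygon n rad P) :
  exists a : R -> R,
    piecewise_cos n a /\ slab_surface rad P = param_surface n rad a.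
Proof.
exists (sector_cos R n); split; first exact: piecewise_cos_sector_cos.
rewrite (base_polygonE R n hn rad P hrad hP).
have rad0 : 0 <= rad := ltW hrad.
apply/seteqP; split=> [[[x y] z] [zr [lambda [l0 + +]]]|[[x y] z]].
  case/andP: zr => z0 zr.
  rewrite area_eqP// homothety_polygon// boundary_polygon//=.
  move=> lz [xyP [j jln jE]].
  have zr1 : 0 <= z / rad <= 1 by rewrite divr_ge0//= ler_pdivrMr// mul1r.
  have zr2 : -1 <= z / rad <= 1 by case/andP: zr1 => *; apply/andP; split; lra.
  have [s [t [i [s0 trg [xE yE] iln ti]]]] := sectorP R n hn (x, y).
  (* The parameters are the polar angle of [(x, y)] and the angle with sine [z / rad]. *)
  exists t, (asin (z / rad)); split.
  - rewrite -/(step R n); lra.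
  - rewrite asin_lepi2// andbT leNgt; apply/negP => asin_lt0.
    have pi0 := pi_gt0 R; have asin_ge := asin_geNpi2 zr2.
    have : sin (asin (z / rad)) < sin 0.
      by rewrite ltr_sin// in_itv/=; apply/andP; split; lra.
    by rewrite asinK ?in_itv// sin0 ltNge; case/andP: zr1 => ->.
  - rewrite asinK ?in_itv// cos_asin// -lz sqrtr_sqr ger0_norm//.
    rewrite (sector_cosE _ _ hn _ _ iln ti).
    have c0 := cos_sector_gt0 R n hn t i ti.
    (* One inequality is membership in the polygon. For the other, side [j] attains [lambda * rad],
       and sector [i] has the largest cosine. *)
    have sE : s * cos (t - i%:R * step R n) = lambda * rad.
      apply/le_anti/andP; split.
        by rewrite -side_form_polar -xE -yE; exact: xyP.
      rewrite -jE xE yE side_form_polar ler_wpM2l//; exact: sector_max.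
    rewrite xE yE; have -> : s = lambda * rad / cos (t - i%:R * step R n).
      by rewrite -sE mulfK// gt_eqF.
    by congr (_, _, _); field; rewrite gt_eqF.
move=> [t [u [trg /andP[u0 u1] [-> -> ->]]]].
have pi0 := pi_gt0 R.
have su : 0 <= sin u by apply: sin_ge0_pi; apply/andP; split; lra.
have cu : 0 <= cos u by apply: cos_ge0_pihalf; apply/andP; split; lra.
have n0 : (0 < n)%N by exact: leq_trans hn.
have /andP[t1 t2] : - (step R n / 2) <= t <= n%:R * step R n - step R n / 2.
  by move: trg; rewrite -/(step R n); lra.
have [i iln ti] := sector_exists R (step R n) t n n0 t1 t2.
have c0 := cos_sector_gt0 R n hn t i ti.
rewrite (sector_cosE _ _ hn _ _ iln ti).
set c := cos (t - i%:R * step R n) in c0 *.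
split; first by rewrite mulr_ge0// ler_piMr// sin_le1.
(* At height [rad * sin u] the equation for the ratio becomes [cos u ^+ 2 = 1 - sin u ^+ 2]. *)
exists (cos u); split=> //.
  apply/area_eqP => //; first exact: mulr_ge0.
  by rewrite cos2sin2 mulrAC divff ?mul1r// gt_eqF.
rewrite homothety_polygon// boundary_polygon//=.
have s0 : 0 <= rad / c * cos u by rewrite mulr_ge0// divr_ge0// ltW.
(* With this polar radius, the inequality of side [i] is an equality. *)
have sE : rad / c * cos u * c = cos u * rad by field; rewrite gt_eqF.
rewrite (mulrAC _ (cos t)) (mulrAC _ (sin t)); split.
  by apply/(polygon_sector _ _ hn _ _ _ _ s0 iln ti); rewrite -/c sE.
by exists i => //; rewrite side_form_polar -/c sE.
Qed.
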